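(* Let $q\ge 1$, let $M\ge 1$ and let $a_1,\dots,a_M\in[0,q]$. Put $a_u=\max_{k}a_k$ and $a_l=\min_k a_k$. For $a\in[0,q]$ and $z\in\mathbb{C}$ let $\lambda_a^{+}(z),\lambda_a^{-}(z)$ be the two roots of $X^2-(z+2+a)X+z+q+1=0$, i.e. $\lambda_a^{\pm}(z)=\tfrac12\bigl(z+2+a\pm\sqrt{(z+a)^2-4(q-a)}\bigr)$, and let $\lambda_a(z)$ denote the one of these two roots with the greatest modulus. Call an element of the family $\{\lambda^{\pm}_{a_k}(z): k=1,\dots,M\}$ dominant at $z$ if its modulus is maximal in this family. Write $z=c+id$ with $c,d\in\mathbb{R}$. Then: (i) for every $z$ with $c>-a_l$ which does not belong to the real segment $\{z=c:\ c\in[-a_l,\max(-a_l,-a_u+2\sqrt{q-a_u})]\}$, there is only one dominant eigenvalue at $z$, namely $\lambda_{a_u}(z)$; (ii) for every $z$ with $c<-a_u-2$ which does not belong to the real segment $\{z=c:\ c\in[\min(-a_u-2,-a_l-2\sqrt{q-a_l}),-a_u-2]\}$, there is only one dominant eigenvalue at $z$, namely $\lambda_{a_l}(z)$.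
   Context: These eigenvalues arise in writing a Tutte polynomial of a self-dual graph on the hyperbola $(x-1)(y-1)=q$ in the variable $z=x+y-2$ (so that $xy=z+q+1$) as a sum $\sum_k[\alpha_{a_k}(z)\lambda^+_{a_k}(z)^n+\beta_{a_k}(z)\lambda^-_{a_k}(z)^n]$. ''Only one dominant eigenvalue, namely $\lambda$'' means that $\lambda$ is dominant and every dominant element of the family equals $\lambda$. *)

(* Defs.v *)
From mathcomp Require Import all_boot all_order all_algebra.
From mathcomp Require Export reals complex.
From mathcomp Require Import ring.

Set Implicit Arguments.
Unset Strict Implicit.
Unset Printing Implicit Defensive.

Import Order.TTheory GRing.Theory Num.Theory.
Local Open Scope ring_scope.
Local Open Scope complex_scope.

(* [sqrtc] is the principal square root (nonnegative real part, and
   [sqrtc (-1) = 'i]).  Another branch would at most exchange the two roots. *)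
Definition disc_root (R : realType) (q a : R) (z : R[i]) : R[i] :=
  sqrtc ((z + a%:C) ^+ 2 - 4 * (q - a)%:C).

Definition lambda_plus (R : realType) (q a : R) (z : R[i]) : R[i] :=
  (z + 2 + a%:C + disc_root q a z) / 2.

Definition lambda_minus (R : realType) (q a : R) (z : R[i]) : R[i] :=
  (z + 2 + a%:C - disc_root q a z) / 2.

Lemma lambda_roots (R : realType) (q a : R) (z : R[i]) :
  'X^2 - (z + 2 + a%:C) *: 'X + (z + q%:C + 1)%:P
  = ('X - (lambda_plus q a z)%:P) * ('X - (lambda_minus q a z)%:P).
Proof.
have prodE : lambda_plus q a z * lambda_minus q a z = z + q%:C + 1.
  rewrite /lambda_plus /lambda_minus mulrACA [X in X * _]mulrC -subr_sqr.
  rewrite sqr_sqrtc; have -> : (q - a)%:C = q%:C - a%:C by exact: rmorphB.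
  by move: (a%:C) (q%:C) => u v; field.
have sumE : lambda_plus q a z + lambda_minus q a z = z + 2 + a%:C.
  by rewrite /lambda_plus /lambda_minus; field.
rewrite -prodE -sumE; move: (lambda_plus q a z) (lambda_minus q a z) => x y.
by rewrite -mul_polyC polyCD polyCM; ring.
Qed.

(* The root of greatest modulus.  If both moduli agree this is [lambda_plus];
   two distinct roots of equal modulus cannot give a unique dominant element,
   so no assertion of uniqueness depends on this convention. *)
Definition lambda_big (R : realType) (q a : R) (z : R[i]) : R[i] :=
  if `|lambda_minus q a z| <= `|lambda_plus q a z| then lambda_plus q a z
  else lambda_minus q a z.

Definition in_family (R : realType) (q : R) (M : nat) (a : 'I_M -> R)
    (z lam : R[i]) : Prop :=
  exists k : 'I_M, lam = lambda_plus q (a k) z \/ lam = lambda_minus q (a k) z.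

(* The order on [R[i]] is partial, but moduli are real, hence comparable. *)
Definition dominant (R : realType) (q : R) (M : nat) (a : 'I_M -> R)
    (z lam : R[i]) : Prop :=
  in_family q a z lam /\ forall mu, in_family q a z mu -> `|mu| <= `|lam|.

Definition only_dominant (R : realType) (q : R) (M : nat) (a : 'I_M -> R)
    (z lam : R[i]) : Prop :=
  dominant q a z lam /\ forall mu, dominant q a z mu -> mu = lam.

(* The iterated maximum and minimum start from the first value of [a]. *)
Definition family_max (R : realType) (M : nat) (hM : (0 < M)%N)
    (a : 'I_M -> R) : R :=
  \big[Num.max/a (Ordinal hM)]_(k < M) a k.

Definition family_min (R : realType) (M : nat) (hM : (0 < M)%N)
    (a : 'I_M -> R) : R :=
  \big[Num.min/a (Ordinal hM)]_(k < M) a k.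

Definition in_real_segment (R : realType) (u v : R) (z : R[i]) : Prop :=
  exists2 x : R, u <= x <= v & z = x%:C.

(* Main.v *)
(* With [lambda = 1 + w] the two roots at [a] satisfy [w w' = q - a] and
   [w + w' = z + a].  As [q - a] is real and nonnegative, the smaller of [w], [w']
   is [k] times the conjugate of the larger, with [0 <= k <= 1]; so the real parts
   of [w] and [w'] have the sign of [c + a], which decides which root is larger,
   and the moduli agree only if [k = 1].  The product [z + q + 1] of the two roots
   does not depend on [a], so their larger modulus grows with the sum of their
   squared moduli, which is half of [|t|^2 + |D|], where [t = z + 2 + a] and
   [D = t^2 - 4 (z + q + 1)].  This sum is monotone in [a], because its tangent
   at [a] (Cauchy-Schwarz bounds [|D|] from below) has a slope of known sign. *)
Require Import Defs.
From mathcomp Require Import all_boot all_order all_algebra.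
From mathcomp Require Import ring lra.

Set Implicit Arguments.
Unset Strict Implicit.

Import Order.TTheory GRing.Theory Num.Theory.
Local Open Scope ring_scope.
Local Open Scope complex_scope.

(** * Moduli compared through their squares *)

Lemma normc_le_sqr (R : rcfType) (x y u v : R) :
  (`|x +i* y| <= `|u +i* v|) = (x ^+ 2 + y ^+ 2 <= u ^+ 2 + v ^+ 2).
Proof.
by rewrite !normc_def lecR /= ler_sqrt // addr_ge0 // sqr_ge0.
Qed.

Lemma normc_lt_sqr (R : rcfType) (x y u v : R) :
  (`|x +i* y| < `|u +i* v|) = (x ^+ 2 + y ^+ 2 < u ^+ 2 + v ^+ 2).
Proof.
rewrite !normc_def ltcR /=; set s := u ^+ 2 + _.
have [s_gt0|s_le0] := ltP 0 s; first by rewrite ltr_sqrt.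
rewrite (ler0_sqrtr s_le0) !ltNge sqrtr_ge0 /=.
by rewrite (le_trans s_le0) // addr_ge0 // sqr_ge0.
Qed.

(** * Parametrisation of the two roots *)

(* [1 + x + i y] and [1 + k (x - i y)] are the two roots at [a]. *)
Record root_param (R : realType) (q c d a x y k : R) : Prop := RootParam {
  root_k : 0 <= k <= 1;
  root_re : (1 + k) * x = c + a;
  root_im : (1 - k) * y = d;
  root_prod : k * (x ^+ 2 + y ^+ 2) = q - a
}.

(** Put [w = x + i y] and [w' = x' + i y']. Multiplying [w w' = r] by the conjugate of [w] gives
    [k = r / |w|^2], and [|w'| <= |w|] forces [k <= 1]. As [A] is nonzero, the larger factor [w]
    cannot vanish. *)
Lemma conj_ratio (R : realFieldType) (r A x y x' y' : R) :
    0 <= r -> A != 0 -> x * x' - y * y' = r -> x * y' + y * x' = 0 ->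
    x + x' = A -> x' ^+ 2 + y' ^+ 2 <= x ^+ 2 + y ^+ 2 ->
  exists k, [/\ 0 <= k <= 1, x' = k * x, y' = - (k * y)
              & k * (x ^+ 2 + y ^+ 2) = r].
Proof.
move=> r0 A0 eR eI eA le_w.
have W0 : 0 < x ^+ 2 + y ^+ 2.
  rewrite lt0r addr_ge0 ?sqr_ge0 // andbT; apply/negP => /eqP W0.
  have x0 : x = 0 by nra.
  have x'0 : x' = 0 by nra.
  by move/eqP: A0; apply; rewrite -eA x0 x'0 addr0.
have Wn := lt0r_neq0 W0.
exists (r / (x ^+ 2 + y ^+ 2)).
have ex : x' = r / (x ^+ 2 + y ^+ 2) * x.
  apply: (mulIf Wn); rewrite mulrAC mulfVK //.
  by rewrite -eR; have := congr1 ( *%R y) eI; lra.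
have ey : y' = - (r / (x ^+ 2 + y ^+ 2) * y).
  apply: (mulIf Wn); rewrite mulNr mulrAC mulfVK //.
  by rewrite -eR; have := congr1 ( *%R x) eI; lra.
split; rewrite ?mulfVK //; move: ex ey.
have : 0 <= r / (x ^+ 2 + y ^+ 2) by rewrite divr_ge0 // ltW.
move: (r / _) => k k0 ex ey; rewrite k0 /=.
move: le_w; rewrite ex ey sqrrN !exprMn -mulrDr ger_pMl //.
by rewrite expr_le1.
Qed.

(** The disjunction is there because the principal square root may put either the larger or the
    smaller of [w], [w'] into [lambda_plus]. *)
Lemma lambda_param (R : realType) (q c d a : R) : a <= q -> c + a != 0 ->
  exists x y k : R, root_param q c d a x y k /\
    let L := (1 + x) +i* y in let L' := (1 + k * x) +i* (- (k * y)) in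
    (lambda_plus q a (c +i* d) = L /\ lambda_minus q a (c +i* d) = L') \/
    (lambda_plus q a (c +i* d) = L' /\ lambda_minus q a (c +i* d) = L).
Proof.
move=> aq A0.
(* The coefficients of degree 0 and 1 give the product and the sum of the roots, so the square root
   itself is never computed. *)
have /(congr1 (fun p : {poly R[i]} => (p`_0, p`_1))) := lambda_roots q a (c +i* d).
move: (lambda_plus _ _ _) (lambda_minus _ _ _) => lp lm.
have -> : ('X - lp%:P) * ('X - lm%:P) = 'X^2 - (lp + lm) *: 'X + (lp * lm)%:P.
  by rewrite -mul_polyC polyCD polyCM; ring.
rewrite !(coefD, coefN, coefZ, coefXn, coefX, coefC) /=.
rewrite !(mulr0, mulr1, oppr0, add0r, addr0).
case: lp => p1 p2; case: lm => m1 m2 [prodR prodI sumR sumI].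
(* Sum and product are symmetric, so one argument serves both orders of the roots; the root farther
   from [1] comes first. *)
have sym (x y x' y' : R) : x * x' - y * y' = c + q + 1 -> x * y' + y * x' = d ->
    x + x' = c + 2 + a -> y + y' = d ->
    (x' - 1) ^+ 2 + y' ^+ 2 <= (x - 1) ^+ 2 + y ^+ 2 ->
  exists x0 y0 k, root_param q c d a x0 y0 k /\
    [/\ x = 1 + x0, y = y0, x' = 1 + k * x0 & y' = - (k * y0)].
  move=> e1 e2 e3 e4 lew.
  have [||||k [k01 ex ey er]] := @conj_ratio R (q - a) (c + a)
    (x - 1) y (x' - 1) y' _ A0 _ _ _ lew; try nra.
  exists (x - 1), y, k; do !split => //; nra.
have [lew|/ltW lew] := leP ((m1 - 1) ^+ 2 + m2 ^+ 2) ((p1 - 1) ^+ 2 + p2 ^+ 2).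
  have [||||x [y [k [h [-> -> -> ->]]]]] := sym p1 p2 m1 m2 _ _ _ _ lew; try nra.
  by exists x, y, k; split => //; left.
have [||||x [y [k [h [-> -> -> ->]]]]] := sym m1 m2 p1 p2 _ _ _ _ lew; try nra.
by exists x, y, k; split => //; right.
Qed.

(** * Moduli of the roots at one parameter and at two *)

Lemma root_normM (R : realType) (q c d a x y k : R) :
  root_param q c d a x y k ->
  ((1 + x) ^+ 2 + y ^+ 2) * ((1 + k * x) ^+ 2 + (k * y) ^+ 2)
    = (c + q + 1) ^+ 2 + d ^+ 2.
Proof.
case=> _ eR eI er.
have -> : c + q + 1 = (1 + k) * x + k * (x ^+ 2 + y ^+ 2) + 1.
  by rewrite eR er; ring.
by rewrite -eI; ring.
Qed.

(** As [1 + k > 0], [x] has the sign of [c + a]. The sign hypothesis means [c + a > 0] or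
    [c + a < -2], so both half-planes are treated at once. *)
Lemma root_re_sign (R : realType) (q c d a x y k : R) :
  root_param q c d a x y k -> 0 < (c + a) * (c + a + 2) ->
  0 < x * (c + a + 2).
Proof.
case=> /andP[k0 _] eR _ _; rewrite -{1}eR -mulrA pmulr_rgt0 //; lra.
Qed.

(** The difference of the squared moduli has the factor [1 - k]; the cofactor is positive because
    [(1 + k) * x = c + a] turns its first term into [x * (c + a + 2)]. *)
Lemma root_norm_lt (R : realType) (q c d a x y k : R) :
  root_param q c d a x y k -> 0 < (c + a) * (c + a + 2) -> k < 1 ->
  (1 + k * x) ^+ 2 + (k * y) ^+ 2 < (1 + x) ^+ 2 + y ^+ 2.
Proof.
move=> h A0 k1; have := root_re_sign h A0.
case: h => /andP[k0 _] <- _ _ x0; rewrite -subr_gt0.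
have -> : (1 + x) ^+ 2 + y ^+ 2 - ((1 + k * x) ^+ 2 + (k * y) ^+ 2)
    = (1 - k) * (x * ((1 + k) * x + 2) + (1 + k) * y ^+ 2) by ring.
by rewrite mulr_gt0 ?subr_gt0 // ltr_pwDl // mulr_ge0 ?sqr_ge0 //; lra.
Qed.

Lemma root_norm_le (R : realType) (q c d a x y k : R) :
  root_param q c d a x y k -> 0 < (c + a) * (c + a + 2) ->
  (1 + k * x) ^+ 2 + (k * y) ^+ 2 <= (1 + x) ^+ 2 + y ^+ 2.
Proof.
move=> h A0; have [k1|k1] := ltP k 1; first exact/ltW/(root_norm_lt h).
case: h => /andP[_ k1'] _ _ _.
by have -> : k = 1 by [apply/le_anti/andP]; rewrite !mul1r.
Qed.

(** Twice the difference of the sums, multiplied by [N], is at least a positive first-order term in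
    [b - a] plus [(b - a)^2 * (N + D1)], which is nonnegative. The hypothesis [k < 1] keeps [N]
    positive. *)
Lemma root_norm_sum_lt (R : realType) (q c d a b x y k u v l : R) :
  root_param q c d a x y k -> root_param q c d b u v l ->
  0 < (c + a) * (c + a + 2) -> 0 < (b - a) * (c + a) -> k < 1 ->
  (1 + x) ^+ 2 + y ^+ 2 + ((1 + k * x) ^+ 2 + (k * y) ^+ 2)
   < (1 + u) ^+ 2 + v ^+ 2 + ((1 + l * u) ^+ 2 + (l * v) ^+ 2).
Proof.
move=> ha hb A0 ab0 k1.
have xA := root_re_sign ha A0.
case: ha hb => /andP[k0 _] eR eI er [/andP[l0 l1] eR' eI' er'].
(* [N] and [N'] are the moduli of the discriminants at [a] and [b]. *)
set N := ((1 - k) * x) ^+ 2 + ((1 + k) * y) ^+ 2.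
set N' := ((1 - l) * u) ^+ 2 + ((1 + l) * v) ^+ 2.
have Sa : 2 * ((1 + x) ^+ 2 + y ^+ 2 + ((1 + k * x) ^+ 2 + (k * y) ^+ 2))
    = (c + a + 2) ^+ 2 + d ^+ 2 + N by rewrite -eR -eI /N; ring.
have Sb : 2 * ((1 + u) ^+ 2 + v ^+ 2 + ((1 + l * u) ^+ 2 + (l * v) ^+ 2))
    = (c + b + 2) ^+ 2 + d ^+ 2 + N' by rewrite -eR' -eI' /N'; ring.
rewrite -(ltr_pM2l (ltr0Sn R 1)) Sa Sb.
(* Real and imaginary parts of the discriminant [(z + a)^2 - 4 (q - a)]; [E1] and [E2] are those at
   [b]. *)
set D1 := (c + a) ^+ 2 - d ^+ 2 - 4 * (q - a).
set D2 := 2 * (c + a) * d.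
have DN : D1 ^+ 2 + D2 ^+ 2 = N ^+ 2 by rewrite /D1 /D2 /N -eR -eI -er; ring.
set E1 := (c + b) ^+ 2 - d ^+ 2 - 4 * (q - b).
set E2 := 2 * (c + b) * d.
have EN : E1 ^+ 2 + E2 ^+ 2 = N' ^+ 2.
  by rewrite /E1 /E2 /N' -eR' -eI' -er'; ring.
have x0 : x != 0 by apply: contraTneq xA => ->; rewrite mul0r ltxx.
have N0 : 0 < N.
  rewrite ltr_pwDl ?sqr_ge0 // exprMn mulr_gt0 // lt0r sqr_ge0 sqrf_eq0 ?x0 //.
  by rewrite andbT; lra.
have N'0 : 0 <= N' by rewrite addr_ge0 ?sqr_ge0.
have CS : D1 * E1 + D2 * E2 <= N * N'.
  apply: le_trans (ler_norm _) _.
  rewrite -ler_sqr ?nnegrE ?normr_ge0 ?mulr_ge0 ?(ltW N0) //.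
  rewrite real_normK ?num_real // exprMn -DN -EN -subr_ge0.
  have -> : (D1 ^+ 2 + D2 ^+ 2) * (E1 ^+ 2 + E2 ^+ 2)
    - (D1 * E1 + D2 * E2) ^+ 2 = (D1 * E2 - D2 * E1) ^+ 2 by ring.
  exact: sqr_ge0.
have ND : 0 <= N + D1.
  rewrite leNgt; apply/negP => lt0; have := sqr_ge0 D2.
  clearbody N D1 D2; nra.
rewrite -(ltr_pM2l N0) -subr_gt0.
set slope := x * (c + a + 2) + (1 + k) * y ^+ 2.
have eD : D1 * E1 + D2 * E2 = N ^+ 2
    + 2 * (b - a) * (D1 * (c + a + 2) + D2 * d) + (b - a) ^+ 2 * D1.
  by rewrite -DN /E1 /E2 /D1 /D2; ring.
(* The left side is [N / 2] times the derivative of [|t|^2 + |D|] in [a]; the factored form shows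
   that it has the sign of [x]. *)
have eS : N * (c + a + 2) + (D1 * (c + a + 2) + D2 * d)
    = 2 * (1 - k) ^+ 2 * x * slope.
  by rewrite /slope /N /D1 /D2 -er -eI -eR; ring.
have S0 : 0 < slope by rewrite ltr_pwDl // mulr_ge0 ?sqr_ge0 //; lra.
have bx : 0 < (b - a) * x.
  by move: ab0; rewrite -eR mulrCA pmulr_rgt0 //; lra.
have := mulr_gt0 (mulr_gt0 bx S0) (_ : 0 < (1 - k) ^+ 2).
rewrite exprn_gt0 ?subr_gt0 // => /(_ isT) P0.
have Q0 := mulr_ge0 (sqr_ge0 (b - a)) ND.
have := congr1 ( *%R (4 * (b - a))) eS.
nra.
Qed.

Lemma root_norm_mono (R : realType) (q c d a b x y k u v l : R) :
  root_param q c d a x y k -> root_param q c d b u v l ->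
  0 < (c + a) * (c + a + 2) -> 0 < (c + b) * (c + b + 2) ->
  0 < (b - a) * (c + a) -> l < 1 ->
  (1 + x) ^+ 2 + y ^+ 2 < (1 + u) ^+ 2 + v ^+ 2.
Proof.
move=> ha hb A0 B0 ab0 l1.
have := root_norm_lt hb B0 l1; have := root_norm_le ha A0.
have := root_norm_sum_lt ha hb A0 ab0.
have : ((1 + x) ^+ 2 + y ^+ 2) * ((1 + k * x) ^+ 2 + (k * y) ^+ 2)
  = ((1 + u) ^+ 2 + v ^+ 2) * ((1 + l * u) ^+ 2 + (l * v) ^+ 2).
  by rewrite (root_normM ha) (root_normM hb).
have sqr_add_ge0 (s t : R) : 0 <= s ^+ 2 + t ^+ 2 by rewrite addr_ge0 ?sqr_ge0.
have := sqr_add_ge0 (1 + l * u) (l * v).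
have := sqr_add_ge0 (1 + k * x) (k * y).
have [k1|k1] := ltP k 1; last first.
  have -> : k = 1 by apply/le_anti/andP; split => //; case: ha => /andP[].
  rewrite !mul1r.
  move: (_ + y ^+ 2) (_ + v ^+ 2) (_ + (l * v) ^+ 2) => p p' s'.
  move=> p0 s0 e _ _ lt; rewrite ltNge; apply/negP => le.
  nra.
(* With equal products, the larger sum goes with the larger difference [p' - s'], hence with the
   larger [p']. *)
move: (_ + y ^+ 2) (_ + v ^+ 2) (_ + (k * y) ^+ 2) (_ + (l * v) ^+ 2).
move=> p p' s s' s0 s'0 e /(_ isT) lt_sum le1 lt1.
rewrite ltNge; apply/negP => le.
nra.
Qed.

(** * Unique dominance at an extreme parameter *)

(** Here [a m] is the largest value in the right half-plane and the smallest in the left one. The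
    last hypothesis excludes the real points where the two roots at [a m] are conjugate or equal. *)
Lemma only_dominant_lambda_big (R : realType) (q c d : R) (M : nat)
    (a : 'I_M -> R) (m : 'I_M) :
  (forall k, a k <= q) -> (forall k, 0 < (c + a k) * (c + a k + 2)) ->
  (forall k, a k != a m -> 0 < (a m - a k) * (c + a k)) ->
  ~ (d = 0 /\ (c + a m) ^+ 2 <= 4 * (q - a m)) ->
  only_dominant q a (c +i* d) (lambda_big q (a m) (c +i* d)).
Proof.
move=> aq sgn_a mono not_slit.
have cn0 k : c + a k != 0.
  by apply: contraTneq (sgn_a k) => ->; rewrite mul0r ltxx.
have [u [v [l [hb eb]]]] := lambda_param d (aq m) (cn0 m).
(* If [l = 1], then [d = 0], [c + a m = 2 * u] and [q - a m = u ^+ 2 + v ^+ 2], which is an excluded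
   point. *)
have l1 : l < 1.
  rewrite ltNge; apply/negP => l1; apply: not_slit.
  case: hb => /andP[_ l1'] eR eI er.
  have el : l = 1 by apply/le_anti/andP.
  rewrite el in eR eI er; split; first by rewrite -eI subrr mul0r.
  by rewrite -eR -er; have := sqr_ge0 v; nra.
have lt_b := root_norm_lt hb (sgn_a m) l1.
have -> : lambda_big q (a m) (c +i* d) = (1 + u) +i* v.
  rewrite /lambda_big; case: eb => [[-> ->]|[-> ->]]; rewrite normc_le_sqr sqrrN.
    by rewrite ltW.
  by rewrite leNgt lt_b.
set L := _ +i* v.
have fam mu : in_family q a (c +i* d) mu -> mu = L \/ `|mu| < `|L|.
  (* Values are compared rather than indices, since [a] may take the value [a m] several times. *)
  case=> k; have [-> in_b|ne_b in_k] := eqVneq (a k) (a m).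
    have : mu = L \/ mu = (1 + l * u) +i* (- (l * v)).
      by case: eb in_b => [[-> ->]|[-> ->]] [] ->; [left|right|right|left].
    by case=> ->; [left|right; rewrite normc_lt_sqr sqrrN].
  right; have [x [y [j [ha ea]]]] := lambda_param d (aq k) (cn0 k).
  have lt_L := root_norm_mono ha hb (sgn_a k) (sgn_a m) (mono k ne_b) l1.
  have le_k := root_norm_le ha (sgn_a k).
  have : mu = (1 + x) +i* y \/ mu = (1 + j * x) +i* (- (j * y)).
    by case: ea in_k => [[-> ->]|[-> ->]] [] ->; [left|right|right|left].
  by case=> ->; rewrite normc_lt_sqr ?sqrrN //; apply: le_lt_trans lt_L.
have L_fam : in_family q a (c +i* d) L.
  by exists m; case: eb => [[-> ->]|[-> ->]]; [left|right].
split; first by split=> // mu /fam [->//|/ltW].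
move=> mu [/fam [->//|lt_mu] /(_ _ L_fam) le_mu].
by have := lt_le_trans lt_mu le_mu; rewrite ltxx.
Qed.

(** * Extreme parameters and the real segments *)

Lemma family_max_attained (R : realType) (M : nat) (hM : (0 < M)%N)
    (a : 'I_M -> R) : exists m, family_max hM a = a m.
Proof.
rewrite /family_max; elim/big_ind: _ => [|_ _ [i ->] [j ->]|i _].
- by exists (Ordinal hM).
- by case: (leP (a i) (a j)) => _; [exists j|exists i].
- by exists i.
Qed.

Lemma family_min_attained (R : realType) (M : nat) (hM : (0 < M)%N)
    (a : 'I_M -> R) : exists m, family_min hM a = a m.
Proof.
rewrite /family_min; elim/big_ind: _ => [|_ _ [i ->] [j ->]|i _].
- by exists (Ordinal hM).
- by case: (leP (a i) (a j)) => _; [exists i|exists j].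
- by exists i.
Qed.

(** With [s = c + a m] and [r = q - a m], this turns the excluded real points into the square-root
    endpoints of the segments. *)
Lemma sqr_le_4M (R : rcfType) (s r : R) : 0 <= r -> s ^+ 2 <= 4 * r ->
  `|s| <= 2 * Num.sqrt r.
Proof.
move=> r0 le_s; rewrite -ler_sqr ?nnegrE ?normr_ge0 ?mulr_ge0 ?sqrtr_ge0 //.
by rewrite real_normK ?num_real // exprMn sqr_sqrtr //; lra.
Qed.

Theorem theorem3p1 (R : realType) (q : R) (hq : 1 <= q)
    (M : nat) (hM : (0 < M)%N) (a : 'I_M -> R)
    (ha : forall k : 'I_M, 0 <= a k <= q) :
  let a_u := family_max hM a in
  let a_l := family_min hM a in
  (forall c d : R, - a_l < c ->
     ~ in_real_segment (- a_l)
         (Num.max (- a_l) (- a_u + 2 * Num.sqrt (q - a_u))) (c +i* d) ->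
     only_dominant q a (c +i* d) (lambda_big q a_u (c +i* d)))
  /\
  (forall c d : R, c < - a_u - 2 ->
     ~ in_real_segment
         (Num.min (- a_u - 2) (- a_l - 2 * Num.sqrt (q - a_l))) (- a_u - 2)
         (c +i* d) ->
     only_dominant q a (c +i* d) (lambda_big q a_l (c +i* d))).
Proof.
move=> a_u a_l.
have a_le_u k : a k <= a_u by apply: le_bigmax.
have a_ge_l k : a_l <= a k by apply: bigmin_le.
have aq k : a k <= q by case/andP: (ha k).
split=> c d hc not_seg.
  have [m em] := family_max_attained hM a.
  rewrite -/a_u in em; rewrite em in a_le_u not_seg *.
  apply: only_dominant_lambda_big => // [k|k ne|[d0 slit]].
  - by rewrite mulr_gt0 //; have := a_ge_l k; lra.
  - rewrite mulr_gt0 ?subr_gt0 ?lt_neqAle ?ne ?a_le_u //.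
    by have := a_ge_l k; lra.
  apply: not_seg; exists c; last by rewrite d0.
  rewrite (ltW hc) le_max; apply/orP; right.
  have := sqr_le_4M _ slit; rewrite subr_ge0 => /(_ (aq m)).
  by have := ler_norm (c + a m); lra.
have [m em] := family_min_attained hM a.
rewrite -/a_l in em; rewrite em in a_ge_l not_seg *.
apply: only_dominant_lambda_big => // [k|k ne|[d0 slit]].
- by have := a_le_u k; nra.
- rewrite nmulr_rgt0 ?subr_lt0 ?lt_neqAle 1?eq_sym ?ne ?a_ge_l //.
  by have := a_le_u k; lra.
apply: not_seg; exists c; last by rewrite d0.
rewrite (ltW hc) andbT ge_min; apply/orP; right.
have := sqr_le_4M _ slit; rewrite subr_ge0 => /(_ (aq m)).
(* Here [c + a m] is negative, so the bound on its absolute value yields the lower end of the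
   segment. *)
by have := ler_norm (- (c + a m)); rewrite normrN; lra.
Qed.
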